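(* Let $P_0$ and $R_0$ be non-isomorphic posets, each of size $m$, and let $i>m$. Then $D_{m+i+1}(P_iR_i)$ is a node of covtree consisting of $k=C(P_0R_0)+\lceil (i-m)/2\rceil$ posets of size $n=m+i+1$, and the smallest witness of this node has size $|P_iR_i|=2m+2i$. Consequently, for any constant $c$, $|P_iR_i|>n+k+c$ whenever $i-\lceil (i-m)/2\rceil>1+C(P_0R_0)-m+c$.
   Context: For $i\ge 0$, $P_i$ (resp. $R_i$) is obtained by placing $P_0$ (resp. $R_0$) above a chain of $i$ elements, and $P_iR_i$ is their disjoint union. A downset is a downward-closed subset; $D(P)$ is the set of non-empty downsets of $P$ up to isomorphism and $D_n(P)$ those of size $n$. $C(P_0R_0):=|D(P_0)|+|D(R_0)|-|D(P_0)\cap D(R_0)|$. A poset $Q$ is a witness of a set $\Gamma_n$ of unlabelled posets of size $n$ if $D_n(Q)=\Gamma_n$; a node of covtree is such a set $\Gamma_n$ that has at least one witness. *)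

(* Defs.v *)
From mathcomp Require Import all_boot all_order all_algebra.
Set Implicit Arguments. Unset Strict Implicit. Unset Printing Implicit Defensive.

Record fposet := FPoset { carrier :> finType; le : rel carrier }.

Definition is_poset (P : fposet) : Prop :=
  [/\ reflexive (@le P), antisymmetric (@le P) & transitive (@le P)].

Definition psize (P : fposet) : nat := #|carrier P|.

(* P placed above a chain of i elements: chain elements inr 0 < ... < inr (i-1)
   lie below every element of P. *)
Definition above_chain (P : fposet) (i : nat) : fposet :=
  @FPoset (carrier P + 'I_i)%type
    (fun x y => match x, y with
                | inl a, inl b => le a b
                | inr a, inr b => (a <= b)%N
                | inr _, inl _ => true
                | inl _, inr _ => false
                end).

Definition disj_union (P Q : fposet) : fposet :=
  @FPoset (carrier P + carrier Q)%type
    (fun x y => match x, y with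
                | inl a, inl b => le a b
                | inr a, inr b => le a b
                | _, _ => false
                end).

Definition is_downset (P : fposet) (S : {set P}) : bool :=
  [forall x in S, forall y : P, le y x ==> (y \in S)].

Definition downsets (P : fposet) : {set {set P}} :=
  [set S : {set P} | is_downset S && (0 < #|S|)%N].
Definition downsets_n (P : fposet) (n : nat) : {set {set P}} :=
  [set S : {set P} | is_downset S && (#|S| == n)].

Definition iso_sub (P Q : fposet) (S : {set P}) (S' : {set Q}) : bool :=
  [exists f : {ffun P -> Q},
    [&& [forall x in S, forall y in S, (f x == f y) ==> (x == y)],
        [set f x | x in S] == S' &
        [forall x in S, forall y in S, le x y == le (f x) (f y)]]].

Definition iso_poset (P Q : fposet) : bool := iso_sub [set: P] [set: Q].

Definition iso_class (P : fposet) (S : {set P}) : {set {set P}} :=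
  [set S' : {set P} | iso_sub S S'].

Definition numD (P : fposet) : nat :=
  #|[set iso_class S | S in downsets P]|.

Definition numDn (P : fposet) (n : nat) : nat :=
  #|[set iso_class S | S in downsets_n P n]|.

Definition numD_inter (P R : fposet) : nat :=
  #|[set iso_class S | S in [set S in downsets P |
        [exists S' in downsets R, iso_sub S S']]]|.

Definition Cconst (P R : fposet) : nat := numD P + numD R - numD_inter P R.

Definition same_Dn (n : nat) (P Q : fposet) : Prop :=
  (forall S, S \in downsets_n P n -> exists2 S', S' \in downsets_n Q n & iso_sub S S') /\
  (forall S', S' \in downsets_n Q n -> exists2 S, S \in downsets_n P n & iso_sub S' S).

Definition witness (n : nat) (P Q : fposet) : Prop := is_poset Q /\ same_Dn n Q P.

Definition covtree_node (n : nat) (P : fposet) : Prop := exists Q : fposet, witness n P Q.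

Definition ceil_half (a : nat) : nat := (a.+1)./2.

(* Main.v *)
Require Import Defs.
From mathcomp Require Import all_boot all_order all_algebra.
From mathcomp Require Import zify.
Import GRing.Theory Num.Theory.
Set Implicit Arguments. Unset Strict Implicit. Unset Printing Implicit Defensive.

(* A downset of P_iR_i is determined by downsets A of P0 and B of R0 and the lengths a, b
   of the initial segments of the two chains it contains, the chain under a non-empty A
   (or B) being full.  For size n = m + i + 1 with i > m this leaves three shapes: a
   non-empty downset D of P0 with its full chain and m + 1 - |D| points of the other chain,
   the same for R0, and two bare chains of lengths a and n - a with m < a <= i.  The points
   with at least i points strictly below them are exactly those of P0 and R0, so an
   isomorphism of such downsets restricts to one of their P0/R0-parts, while two pairs of
   bare chains are isomorphic iff their longer chains have the same length.  Counting the
   classes gives C(P0R0) + ceil((i - m)/2).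
   A witness Q contains copies K and L of the components P_i and R_i, inside copies of the
   size-n downsets containing them.  Every size-n downset of P_iR_i has exactly two minimal
   points, the bottoms of the chains, with no common lower bound; so no size-n downset of Q
   has a least element or three minimal points.  The first fact keeps K and L from sharing
   their bottom (K = L would make P0 and R0 isomorphic), the second makes the bottom of L
   the other minimal point of the copy containing K, which lies below no point of K.  Hence
   K and L are disjoint and |Q| >= 2(m + i). *)

Lemma card_imset_le_ker (T U V : finType) (A : {set T}) (F : T -> U) (G : T -> V) :
  {in A &, forall x y, F x = F y -> G x = G y} -> #|G @: A| <= #|F @: A|.
Proof.
move=> FG; case: (set_0Vmem A) => [->|[x0 x0A]]; first by rewrite !imset0 !cards0.
pose h u := if [pick x in A | F x == u] is Some x then G x else G x0.
apply: leq_trans (leq_imset_card h _); apply/subset_leq_card/subsetP => _ /imsetP[x xA ->].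
apply/imsetP; exists (F x); first exact: imset_f.
rewrite /h; case: pickP => [x' /andP[x'A /eqP]|/(_ x)]; last by rewrite xA eqxx.
by move=> /FG ->.
Qed.

Lemma card_imset_eq_ker (T U V : finType) (A : {set T}) (F : T -> U) (G : T -> V) :
  {in A &, forall x y, (F x == F y) = (G x == G y)} -> #|F @: A| = #|G @: A|.
Proof.
move=> FG; apply/eqP; rewrite eqn_leq !card_imset_le_ker // => x y xA yA /eqP.
  by rewrite FG // => /eqP.
by rewrite -FG // => /eqP.
Qed.

Lemma card_ord_prefix i k : #|[set j : 'I_i | j < k]| = minn k i.
Proof.
have -> : [set j : 'I_i | j < k] = widen_ord (geq_minr k i) @: [set: 'I_(minn k i)].
  apply/setP => j; rewrite inE; apply/idP/imsetP => [jk|[j' _ ->]].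
    have jki : j < minn k i by rewrite leq_min jk ltn_ord.
    by exists (Ordinal jki) => //; apply: val_inj.
  by rewrite /= (leq_trans (ltn_ord j')) ?geq_minl.
by rewrite card_imset ?cardsT ?card_ord // => x y /(congr1 val) e; apply: val_inj.
Qed.

Lemma ord_prefix_mem i (A : {set 'I_i}) :
  (forall a b : 'I_i, a \in A -> b <= a -> b \in A) ->
  forall a : 'I_i, (a \in A) = (a < #|A|).
Proof.
move=> Adown a; apply/idP/idP => [aA|].
- rewrite -[a : nat](minn_idPl (ltnW (ltn_ord a))) -card_ord_prefix.
  apply/proper_card/properP; split.
    by apply/subsetP => j; rewrite inE => ja; apply: Adown aA _; rewrite ltnW.
  by exists a; rewrite // inE ltnn.
- apply: contraLR; rewrite -leqNgt => aA.
  apply: leq_trans (geq_minl a i); rewrite -card_ord_prefix.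
  apply/subset_leq_card/subsetP => b bA.
  by rewrite inE ltnNge; apply: contra aA => ab; apply: Adown bA ab.
Qed.

Lemma card_set_sum (A B : finType) (S : {set A + B}) :
  #|S| = #|[set a | inl a \in S]| + #|[set b | inr b \in S]|.
Proof.
rewrite -(card_imset _ (@inl_inj A B)) -(card_imset _ (@inr_inj A B)) -cardsUI.
set SA := [set a | inl a \in S]; set SB := [set b | inr b \in S].
have -> : inl @: SA :&: inr @: SB = set0.
  by apply/setP => x; rewrite !inE; apply/andP => -[/imsetP[a _ ->] /imsetP[b _]].
rewrite cards0 addn0; apply: eq_card => -[a|b]; rewrite !inE.
- rewrite (mem_imset _ _ (@inl_inj A B)) inE.
  by case: imsetP => [[y _ //]|]; rewrite orbF.
- rewrite (mem_imset _ _ (@inr_inj A B)) inE.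
  by case: imsetP => [[y _ //]|].
Qed.

Lemma iso_subP (P Q : fposet) (S : {set P}) (S' : {set Q}) :
  reflect (exists f : P -> Q, [/\ {in S &, injective f}, f @: S = S' &
             {in S &, forall x y, le x y = le (f x) (f y)}]) (iso_sub S S').
Proof.
apply: (iffP existsP) => [[f /and3P[/forall_inP fI /eqP fS /forall_inP fle]]|[f [fI fS fle]]].
- exists f; split=> // [x y xS yS fxy|x y xS yS].
    by have /forall_inP/(_ y yS) := fI x xS; rewrite fxy eqxx => /eqP.
  by have /forall_inP/(_ y yS)/eqP := fle x xS.
- exists (finfun f); apply/and3P; split.
  + apply/forall_inP => x xS; apply/forall_inP => y yS; rewrite !ffunE.
    by apply/implyP => /eqP/fI ->.
  + by apply/eqP; rewrite -fS; apply: eq_imset => x; rewrite ffunE.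
  + apply/forall_inP => x xS; apply/forall_inP => y yS; rewrite !ffunE.
    by apply/eqP; apply: fle.
Qed.

Lemma order_embedding_inj (P Q : fposet) (S : {set P}) (f : P -> Q) : is_poset P ->
  {in S &, forall x y, le x y = le (f x) (f y)} -> {in S &, injective f}.
Proof.
case=> Pr Pa _ fle x y xS yS fxy.
by apply: Pa; rewrite !fle // fxy -!fle // Pr.
Qed.

Lemma iso_sub_intro (P Q : fposet) (S : {set P}) (S' : {set Q}) (f : P -> Q) : is_poset P ->
  f @: S = S' -> {in S &, forall x y, le x y = le (f x) (f y)} -> iso_sub S S'.
Proof.
by move=> HP fS fle; apply/iso_subP; exists f; split=> //; apply: order_embedding_inj.
Qed.

Lemma iso_sub_card (P Q : fposet) (S : {set P}) (S' : {set Q}) (f : P -> Q) : is_poset P ->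
  {in S, forall x, f x \in S'} -> #|S'| <= #|S| ->
  {in S &, forall x y, le x y = le (f x) (f y)} -> iso_sub S S'.
Proof.
move=> HP fS cS fle; have fI := order_embedding_inj HP fle.
apply: (iso_sub_intro HP) fle.
apply/eqP; rewrite eqEcard card_in_imset // cS andbT.
by apply/subsetP => _ /imsetP[x xS ->]; apply: fS.
Qed.

Lemma iso_sub_imset (P Q : fposet) (D : {set P}) (e : P -> Q) : is_poset P ->
  (forall x y, le (e x) (e y) = le x y) -> iso_sub D (e @: D).
Proof. by move=> HP ele; apply: iso_sub_intro => // x y _ _; rewrite ele. Qed.

Lemma iso_sub_refl (P : fposet) (S : {set P}) : iso_sub S S.
Proof. by apply/iso_subP; exists id; split=> //; apply: imset_id. Qed.

Lemma iso_sub_sym (P Q : fposet) (S : {set P}) (S' : {set Q}) (x0 : P) :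
  iso_sub S S' -> iso_sub S' S.
Proof.
move=> /iso_subP[f [fI fS fle]].
pose g y := if [pick x in S | f x == y] is Some x then x else x0.
have gK : {in S, cancel f g}.
  move=> x xS; rewrite /g; case: pickP => [x' /andP[x'S /eqP]|/(_ x)]; first exact: fI.
  by rewrite xS eqxx.
apply/iso_subP; exists g; rewrite -fS; split.
- by move=> _ _ /imsetP[x xS ->] /imsetP[y yS ->]; rewrite !gK // => ->.
- by rewrite -imset_comp (eq_in_imset (g := id)) ?imset_id // => x /gK.
- by move=> _ _ /imsetP[x xS ->] /imsetP[y yS ->]; rewrite !gK // fle.
Qed.

Lemma iso_sub_trans (P Q W : fposet) (S : {set P}) (S' : {set Q}) (S'' : {set W}) :
  iso_sub S S' -> iso_sub S' S'' -> iso_sub S S''.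
Proof.
move=> /iso_subP[f [fI fS fle]] /iso_subP[g [gI gS gle]].
have fS' x : x \in S -> f x \in S' by move=> xS; rewrite -fS imset_f.
apply/iso_subP; exists (g \o f); split=> [x y xS yS /gI fxy||x y xS yS /=].
- by apply: fI; rewrite // fxy ?fS'.
- by rewrite imset_comp fS.
- by rewrite fle // gle ?fS'.
Qed.

Lemma iso_sub_of_imset (P Q W : fposet) (y0 : Q) (e1 : P -> W) (e2 : Q -> W)
    (D : {set P}) (E : {set Q}) :
  is_poset P -> is_poset Q ->
  (forall x y, le (e1 x) (e1 y) = le x y) -> (forall x y, le (e2 x) (e2 y) = le x y) ->
  iso_sub (e1 @: D) (e2 @: E) -> iso_sub D E.
Proof.
move=> HP HQ e1le e2le DE.
apply: iso_sub_trans (iso_sub_imset D HP e1le) (iso_sub_trans DE _).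
exact: iso_sub_sym y0 (iso_sub_imset E HQ e2le).
Qed.

Lemma card_iso_sub (P Q : fposet) (S : {set P}) (S' : {set Q}) : iso_sub S S' -> #|S| = #|S'|.
Proof. by case/iso_subP=> f [fI <- _]; rewrite card_in_imset. Qed.

Lemma iso_sub_restrict (P Q : fposet) (S A : {set P}) (f : P -> Q) :
  {in S &, forall x y, le x y = le (f x) (f y)} -> {in S &, injective f} ->
  A \subset S -> iso_sub A (f @: A).
Proof.
move=> fle fI /subsetP AS; apply/iso_subP; exists f.
by split=> // x y /AS xS /AS yS; [apply: fI | apply: fle].
Qed.

Lemma iso_poset_card0 (P Q : fposet) : #|P| = 0 -> #|Q| = 0 -> iso_poset P Q.
Proof.
move=> P0 Q0.
have noP (x : P) : False by move: (card0_eq P0 x); rewrite !inE.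
have noQ (y : Q) : False by move: (card0_eq Q0 y); rewrite !inE.
apply/iso_subP; exists (fun x => match noP x with end).
by split=> [x||x]; [case: (noP x) | apply/setP => y; case: (noQ y) | case: (noP x)].
Qed.

Lemma iso_sub_set0 (P Q : fposet) (y0 : Q) : iso_sub (set0 : {set P}) (set0 : {set Q}).
Proof. by apply/iso_subP; exists (fun=> y0); split=> [x y||x y]; rewrite ?imset0 ?inE. Qed.

Lemma eq_iso_class (P : fposet) (x0 : P) (S T : {set P}) :
  (iso_class S == iso_class T) = iso_sub S T.
Proof.
apply/eqP/idP => [ST|ST].
  have : T \in iso_class T by rewrite inE iso_sub_refl.
  by rewrite -ST inE.
apply/setP => U; rewrite !inE; apply/idP/idP => [SU|TU]; last exact: iso_sub_trans TU.
exact: iso_sub_trans (iso_sub_sym x0 ST) SU.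
Qed.

Lemma card_iso_classes (P Q : fposet) (x0 : P) (y0 : Q) (A : {set {set P}})
    (F : {set P} -> {set Q}) :
  {in A &, forall D D', iso_sub (F D) (F D') = iso_sub D D'} ->
  #|[set iso_class (F D) | D in A]| = #|[set iso_class D | D in A]|.
Proof.
move=> FA; apply: card_imset_eq_ker => D D' DA D'A.
by rewrite (eq_iso_class y0) (eq_iso_class x0) FA.
Qed.

Lemma downsetP (P : fposet) (S : {set P}) :
  reflect (forall x y, x \in S -> le y x -> y \in S) (is_downset S).
Proof.
apply: (iffP forall_inP) => [Sd x y xS yx|Sd x xS].
  by have /forallP/(_ y)/implyP := Sd x xS; apply.
by apply/forallP => y; apply/implyP; apply: Sd.
Qed.

Lemma downset0 (P : fposet) : is_downset (set0 : {set P}).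
Proof. by apply/downsetP => x y; rewrite inE. Qed.

Lemma downsetT (P : fposet) : is_downset [set: P].
Proof. by apply/downsetP => x y; rewrite inE. Qed.

Lemma downsetsT (P : fposet) (x : P) : [set: P] \in downsets P.
Proof. by rewrite inE downsetT card_gt0; apply/set0Pn; exists x; rewrite inE. Qed.

Lemma downsets_nP (P : fposet) (k : nat) (S : {set P}) :
  reflect (is_downset S /\ #|S| = k) (S \in downsets_n P k).
Proof. by rewrite inE; apply: (iffP andP) => -[Sd /eqP]. Qed.

Definition below (P : fposet) (S : {set P}) (x : P) : {set P} :=
  [set y in S | le y x && (y != x)].

Lemma card_below_iso (P Q : fposet) (S : {set P}) (f : P -> Q) :
  {in S &, injective f} -> {in S &, forall x y, le x y = le (f x) (f y)} ->
  {in S, forall x, #|below (f @: S) (f x)| = #|below S x|}.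
Proof.
move=> fI fle x xS.
have -> : below (f @: S) (f x) = f @: below S x.
  apply/setP => y; rewrite inE; apply/andP/imsetP => [[/imsetP[z zS ->]]|[z]].
    by rewrite -fle // (inj_in_eq fI) // => zx; exists z; rewrite // inE zS.
  rewrite inE => /and3P[zS zx zNx] ->; rewrite imset_f // -fle // zx.
  by rewrite (inj_in_eq fI).
by apply: card_in_imset => y z; rewrite !inE => /andP[yS _] /andP[zS _]; apply: fI.
Qed.

Definition upper_part (P : fposet) (h : nat) (S : {set P}) : {set P} :=
  [set x in S | h <= #|below S x|].

Lemma iso_sub_upper_part (P Q : fposet) (h : nat) (S : {set P}) (S' : {set Q}) :
  iso_sub S S' -> iso_sub (upper_part h S) (upper_part h S').
Proof.
case/iso_subP => f [fI <- fle].
have -> : upper_part h (f @: S) = f @: upper_part h S.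
  apply/setP => y; rewrite inE; apply/andP/imsetP => [[/imsetP[x xS ->]]|[x]].
    by rewrite card_below_iso // => hx; exists x; rewrite // inE xS.
  by rewrite inE => /andP[xS hx] ->; rewrite imset_f // card_below_iso.
by apply: iso_sub_restrict fle fI _; apply/subsetP => x; rewrite inE => /andP[].
Qed.

Definition max_below (P : fposet) (S : {set P}) : nat := \max_(x in S) #|below S x|.

Lemma max_below_iso (P Q : fposet) (S : {set P}) (S' : {set Q}) :
  iso_sub S S' -> max_below S = max_below S'.
Proof.
case/iso_subP => f [fI <- fle]; rewrite /max_below big_imset //=.
by apply: eq_bigr => x xS; rewrite card_below_iso.
Qed.

Lemma downset_add_minimal (Q : fposet) (A B : {set Q}) : is_poset Q ->
  is_downset A -> is_downset B -> A \proper B ->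
  exists2 y, y \in B :\: A & is_downset (y |: A).
Proof.
move=> [Qr Qa Qt] /downsetP Ad /downsetP Bd /properP[AB [y0 y0B y0A]].
have y0BA : y0 \in B :\: A by rewrite inE y0A.
case: (arg_minnP (fun y => #|[set u | le u y]|) y0BA) => y yBA ymin.
exists y => //; case/setDP: yBA => yB yA.
apply/downsetP => x z; rewrite !inE => /orP[/eqP->|xA] zx; last by rewrite (Ad x z xA zx) orbT.
case zA: (z \in A); first by rewrite orbT.
have zBA : z \in B :\: A by rewrite inE zA (Bd y z yB zx).
rewrite orbF; apply/eqP/Qa; rewrite zx /=.
apply: contraTT (ymin z zBA) => yz; rewrite -ltnNge.
apply/proper_card/properP; split.
  by apply/subsetP => u; rewrite !inE => uz; apply: Qt zx.
by exists y; rewrite !inE ?Qr.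
Qed.

Lemma exists_downset_between (Q : fposet) (k : nat) (A B : {set Q}) : is_poset Q ->
  is_downset A -> is_downset B -> A \subset B -> #|A| <= k <= #|B| ->
  exists2 Z, Z \in downsets_n Q k & A \subset Z /\ Z \subset B.
Proof.
move=> HQ + Bd; move Ed: (k - #|A|) => d.
elim: d A Ed => [|d IH] A Ed Ad AB /andP[Ak kB].
  by exists A => //; apply/downsets_nP; split=> //; lia.
have ABp : A \proper B by rewrite properEcard AB /=; lia.
have [y] := downset_add_minimal HQ Ad Bd ABp; rewrite inE => /andP[yA yB] yAd.
have [|||Z Zk [yAZ ZB]] := IH (y |: A) _ yAd.
- by rewrite cardsU1 yA; lia.
- by rewrite subUset sub1set yB.
- by rewrite cardsU1 yA kB andbT; lia.
by exists Z => //; split=> //; apply: subset_trans yAZ; apply: subsetUr.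
Qed.

Lemma downset_image (P Q : fposet) (S A : {set P}) (f : P -> Q) :
  is_downset (f @: S) -> {in S &, forall x y, le x y = le (f x) (f y)} ->
  A \subset S -> is_downset A -> is_downset (f @: A).
Proof.
move=> /downsetP fSd fle /subsetP AS /downsetP Ad.
apply/downsetP => _ y /imsetP[x xA ->] yx.
have /imsetP[z zS yz] : y \in f @: S by apply: fSd yx; apply/imset_f/AS.
rewrite {}yz in yx *; apply/imset_f/(Ad x z xA); rewrite fle //; exact: AS.
Qed.

Lemma minimal_image (P Q : fposet) (S : {set P}) (f : P -> Q) (b : P) :
  is_downset (f @: S) -> {in S &, forall x y, le x y = le (f x) (f y)} ->
  b \in S -> (forall z, le z b -> z = b) -> forall y, le y (f b) -> y = f b.
Proof.
move=> /downsetP fSd fle bS bmin y yb.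
have /imsetP[z zS yz] : y \in f @: S by apply: fSd yb; apply: imset_f.
by rewrite yz in yb *; rewrite (bmin z) // fle.
Qed.

(** * The downsets of P_iR_i *)

Lemma above_chain_poset (P : fposet) (i : nat) : is_poset P -> is_poset (above_chain P i).
Proof.
case=> Pr Pa Pt; split.
- by case=> [a|a] /=; [apply: Pr | apply: leqnn].
- case=> [a|a] [b|b] //= ab; first by rewrite (Pa a b ab).
  by congr inr; apply/val_inj/anti_leq.
- by case=> [b|b] [a|a] [c|c] //=; [apply: Pt | apply: leq_trans].
Qed.

Lemma disj_union_poset (P Q : fposet) : is_poset P -> is_poset Q -> is_poset (disj_union P Q).
Proof.
case=> Pr Pa Pt [Qr Qa Qt]; split.
- by case=> [a|a] /=; [apply: Pr | apply: Qr].
- by case=> [a|a] [b|b] //= ab; [rewrite (Pa a b ab) | rewrite (Qa a b ab)].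
- by case=> [b|b] [a|a] [c|c] //=; [apply: Pt | apply: Qt].
Qed.

Section DownsetsOfPR.
Variables (P0 R0 : fposet) (i : nat).
Local Notation PR := (disj_union (above_chain P0 i) (above_chain R0 i)).
Local Notation m := #|P0|.
Local Notation n := (m + i + 1).
Hypotheses (HP : is_poset P0) (HR : is_poset R0) (HRm : #|R0| = m) (Hmi : m < i).
Variables (p0 : P0) (r0 : R0).

(* [pr_set A a B b] is A above the a lowest points of the chain under P0, next to
   B above the b lowest points of the chain under R0; chain point k has k points below it. *)
Definition pr_set (A : {set P0}) (a : nat) (B : {set R0}) (b : nat) : {set PR} :=
  [set x : PR | match x with
                | inl (inl p) => p \in A | inl (inr k) => k < a
                | inr (inl r) => r \in B | inr (inr k) => k < b end].

Lemma card_pr_set A a B b : #|pr_set A a B b| = #|A| + minn a i + #|B| + minn b i.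
Proof.
rewrite !card_set_sum addnA -!card_ord_prefix.
by congr (_ + _ + _ + _); apply: eq_card => x; rewrite !inE.
Qed.

Lemma downset_pr_set (S : {set PR}) : is_downset S ->
  exists A a B b, [/\ a <= i, b <= i & S = pr_set A a B b].
Proof.
move/downsetP=> Sd.
pose CL := [set k | (inl (inr k) : PR) \in S]; pose CR := [set k | (inr (inr k) : PR) \in S].
exists [set p | (inl (inl p) : PR) \in S], #|CL|, [set r | (inr (inl r) : PR) \in S], #|CR|.
have leCi (C : {set 'I_i}) : #|C| <= i by rewrite -[i in _ <= i]card_ord max_card.
split; [exact: leCi | exact: leCi |].
apply/setP => -[[p|k]|[r|k]]; rewrite !inE //=; rewrite -ord_prefix_mem ?inE // => u v;
  rewrite !inE => uS vu; exact: Sd uS _.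
Qed.

Lemma pr_set_downsetP A a B b :
  reflect [/\ is_downset A, is_downset B, A != set0 -> i <= a & B != set0 -> i <= b]
          (is_downset (pr_set A a B b)).
Proof.
apply: (iffP (@downsetP PR _)) => [Sd|[/downsetP Ad /downsetP Bd Aa Bb]].
  split.
  - by apply/downsetP => p q pA qp; have := Sd (inl (inl p)) (inl (inl q)); rewrite !inE; apply.
  - by apply/downsetP => p q pB qp; have := Sd (inr (inl p)) (inr (inl q)); rewrite !inE; apply.
  - case/set0Pn => p pA; rewrite leqNgt; apply/negP => ai.
    by have := Sd (inl (inl p)) (inl (inr (Ordinal ai))); rewrite !inE ltnn => /(_ pA isT).
  - case/set0Pn => p pB; rewrite leqNgt; apply/negP => bi.
    by have := Sd (inr (inl p)) (inr (inr (Ordinal bi))); rewrite !inE ltnn => /(_ pB isT).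
have A0 p : p \in A -> i <= a by move=> pA; apply: Aa; apply/set0Pn; exists p.
have B0 r : r \in B -> i <= b by move=> rB; apply: Bb; apply/set0Pn; exists r.
move=> -[[p|k]|[r|k]] [[q|j]|[s|j]]; rewrite !inE //=.
- exact: Ad.
- by move=> /A0 ia _; apply: leq_trans ia.
- by move=> ka jk; apply: leq_ltn_trans ka.
- exact: Bd.
- by move=> /B0 ib _; apply: leq_trans ib.
- by move=> kb jk; apply: leq_ltn_trans kb.
Qed.

Lemma pr_poset : is_poset PR.
Proof. by apply: disj_union_poset; apply: above_chain_poset. Qed.

Lemma card_below_chainl A a B b (k : 'I_i) :
  k < a -> #|below (pr_set A a B b) (inl (inr k))| = k.
Proof.
move=> ka.
have -> : below (pr_set A a B b) (inl (inr k)) = [set inl (inr j) | j in [set j : 'I_i | j < k]].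
  apply/setP => y; rewrite /below !inE; apply/idP/imsetP => [|[j]].
    case: y => [[p|j]|[r|j]] /=; rewrite ?andbF // => /and3P[_ jk jNk]; exists j => //.
    by rewrite inE ltn_neqAle jk andbT; apply: contra jNk => /eqP/val_inj ->.
  rewrite inE => jk ->; rewrite /= (ltn_trans jk ka) ltnW //=.
  by apply: contraTneq jk => -[->]; rewrite ltnn.
rewrite card_imset ?card_ord_prefix; first exact/minn_idPl/ltnW/ltn_ord.
by move=> u v [].
Qed.

Lemma card_below_chainr A a B b (k : 'I_i) :
  k < b -> #|below (pr_set A a B b) (inr (inr k))| = k.
Proof.
move=> kb.
have -> : below (pr_set A a B b) (inr (inr k)) = [set inr (inr j) | j in [set j : 'I_i | j < k]].
  apply/setP => y; rewrite /below !inE; apply/idP/imsetP => [|[j]].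
    case: y => [[p|j]|[r|j]] /=; rewrite ?andbF // => /and3P[_ jk jNk]; exists j => //.
    by rewrite inE ltn_neqAle jk andbT; apply: contra jNk => /eqP/val_inj ->.
  rewrite inE => jk ->; rewrite /= (ltn_trans jk kb) ltnW //=.
  by apply: contraTneq jk => -[->]; rewrite ltnn.
rewrite card_imset ?card_ord_prefix; first exact/minn_idPl/ltnW/ltn_ord.
by move=> u v [].
Qed.

Lemma upper_part_pr_set A a B b : (A != set0 -> i <= a) -> (B != set0 -> i <= b) ->
  upper_part i (pr_set A a B b) = pr_set A 0 B 0.
Proof.
move=> Aa Bb.
have below_top (x : PR) (c : 'I_i -> PR) : injective c ->
    (forall k, c k \in below (pr_set A a B b) x) -> i <= #|below (pr_set A a B b) x|.
  move=> cI cx; rewrite -[i in i <= _](card_ord i) -cardsT -(card_imset _ cI).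
  by apply/subset_leq_card/subsetP => _ /imsetP[k _ ->].
apply/setP => -[[p|k]|[r|k]]; rewrite /upper_part !inE /= ?ltn0.
- case pA: (p \in A) => //=.
  have ia : i <= a by apply: Aa; apply/set0Pn; exists p.
  apply: (below_top _ (fun k => inl (inr k))) => [u v [] //|k].
  by rewrite /below !inE /= (leq_trans (ltn_ord k) ia).
- have [ka|//] := ltnP k a.
  by rewrite card_below_chainl // leqNgt ltn_ord.
- case rB: (r \in B) => //=.
  have ib : i <= b by apply: Bb; apply/set0Pn; exists r.
  apply: (below_top _ (fun k => inr (inr k))) => [u v [] //|k].
  by rewrite /below !inE /= (leq_trans (ltn_ord k) ib).
- have [kb|//] := ltnP k b.
  by rewrite card_below_chainr // leqNgt ltn_ord.
Qed.

Lemma max_below_chains a b : a <= i -> b <= i ->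
  max_below (pr_set set0 a set0 b) = (maxn a b).-1.
Proof.
move=> ai bi; apply/eqP; rewrite eqn_leq; apply/andP; split.
  apply/bigmax_leqP => -[[p|k]|[r|k]]; rewrite !inE //= => kc.
    by rewrite card_below_chainl //; lia.
  by rewrite card_below_chainr //; lia.
rewrite /max_below; case: (leqP b a) => ba.
  case: a ai ba => [//|a] ai ba.
  have top : (inl (inr (Ordinal ai)) : PR) \in pr_set set0 a.+1 set0 b by rewrite inE /=.
  by apply: leq_trans (leq_bigmax_cond _ top); rewrite card_below_chainl //=; lia.
case: b bi ba => [//|b] bi ba.
have top : (inr (inr (Ordinal bi)) : PR) \in pr_set set0 a set0 b.+1 by rewrite inE /=.
by apply: leq_trans (leq_bigmax_cond _ top); rewrite card_below_chainr //=; lia.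
Qed.

Lemma pr_set_left A : pr_set A 0 set0 0 = [set inl (inl p) | p in A].
Proof.
apply/setP => -[[p|k]|[r|k]]; rewrite !inE ?ltn0 /=.
- by rewrite (mem_imset _ _ (_ : injective (fun p => inl (inl p) : PR))) // => u v [].
- by apply/esym/imsetP => -[].
- by apply/esym/imsetP => -[].
- by apply/esym/imsetP => -[].
Qed.

Lemma pr_set_right B : pr_set set0 0 B 0 = [set inr (inl r) | r in B].
Proof.
apply/setP => -[[p|k]|[r|k]]; rewrite !inE ?ltn0 /=.
- by apply/esym/imsetP => -[].
- by apply/esym/imsetP => -[].
- by rewrite (mem_imset _ _ (_ : injective (fun r => inr (inl r) : PR))) // => u v [].
- by apply/esym/imsetP => -[].
Qed.

Lemma iso_pr_set_upper A a B b A' a' B' b' :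
  is_downset (pr_set A a B b) -> is_downset (pr_set A' a' B' b') ->
  iso_sub (pr_set A a B b) (pr_set A' a' B' b') ->
  iso_sub (pr_set A 0 B 0) (pr_set A' 0 B' 0).
Proof.
move=> /pr_set_downsetP[_ _ Aa Bb] /pr_set_downsetP[_ _ Aa' Bb'] /(iso_sub_upper_part i).
by rewrite !upper_part_pr_set.
Qed.

Lemma iso_pr_set A A' B B' a b :
  iso_sub A A' -> iso_sub B B' -> iso_sub (pr_set A a B b) (pr_set A' a B' b).
Proof.
move=> AA' BB'; case/iso_subP: (AA') => g [_ gA gle]; case/iso_subP: (BB') => h [_ hB hle].
apply: (@iso_sub_card PR PR _ _ (fun x => match x with
  | inl (inl p) => inl (inl (g p)) | inr (inl r) => inr (inl (h r)) | y => y end)).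
- exact: pr_poset.
- by move=> -[[p|k]|[r|k]]; rewrite !inE //= => xA; rewrite -?gA -?hB imset_f.
- by rewrite !card_pr_set (card_iso_sub AA') (card_iso_sub BB').
- by move=> -[[p|k]|[r|k]] [[q|j]|[s|j]]; rewrite !inE //= => ? ?; [apply: gle | apply: hle].
Qed.

Lemma iso_pr_set_swap A B A' B' a b :
  iso_sub A B' -> iso_sub B A' -> iso_sub (pr_set A a B b) (pr_set A' b B' a).
Proof.
move=> AB' BA'; case/iso_subP: (AB') => g [_ gA gle]; case/iso_subP: (BA') => h [_ hB hle].
apply: (@iso_sub_card PR PR _ _ (fun x => match x with
  | inl (inl p) => inr (inl (g p)) | inl (inr k) => inr (inr k)
  | inr (inl r) => inl (inl (h r)) | inr (inr k) => inl (inr k) end)).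
- exact: pr_poset.
- by move=> -[[p|k]|[r|k]]; rewrite !inE //= => xA; rewrite -?gA -?hB imset_f.
- by rewrite !card_pr_set (card_iso_sub AB') (card_iso_sub BA'); lia.
- by move=> -[[p|k]|[r|k]] [[q|j]|[s|j]]; rewrite !inE //= => ? ?; [apply: gle | apply: hle].
Qed.

Definition left_downset (D : {set P0}) : {set PR} := pr_set D i set0 (m.+1 - #|D|).
Definition right_downset (E : {set R0}) : {set PR} := pr_set set0 (m.+1 - #|E|) E i.
Definition chains_downset (a : nat) : {set PR} := pr_set set0 a set0 (n - a).

Lemma left_downset_n D : D \in downsets P0 -> left_downset D \in downsets_n PR n.
Proof.
rewrite inE => /andP[Dd _]; apply/downsets_nP; split.
  by apply/pr_set_downsetP; split; rewrite ?eqxx ?downset0.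
by rewrite card_pr_set cards0; have := max_card D; lia.
Qed.

Lemma right_downset_n E : E \in downsets R0 -> right_downset E \in downsets_n PR n.
Proof.
rewrite inE => /andP[Ed _]; apply/downsets_nP; split.
  by apply/pr_set_downsetP; split; rewrite ?eqxx ?downset0.
by rewrite card_pr_set cards0; have := max_card E; lia.
Qed.

Lemma chains_downset_n a : m < a <= i -> chains_downset a \in downsets_n PR n.
Proof.
move=> ai; apply/downsets_nP; split.
  by apply/pr_set_downsetP; split; rewrite ?eqxx ?downset0.
by rewrite card_pr_set !cards0; lia.
Qed.

Lemma downsets_n_cases S : S \in downsets_n PR n ->
  [\/ exists2 D, D \in downsets P0 & S = left_downset D,
      exists2 E, E \in downsets R0 & S = right_downset E |
      exists2 a, m < a <= i & S = chains_downset a].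
Proof.
case/downsets_nP => Sd cS; have [A [a [B [b [ai bi eS]]]]] := downset_pr_set Sd; subst S.
case/pr_set_downsetP: Sd => Ad Bd Aa Bb; rewrite card_pr_set in cS.
have := max_card A; have := max_card B; rewrite HRm => Bm Am.
have [A0|AN0] := eqVneq A set0; have [B0|BN0] := eqVneq B set0.
- apply: Or33; exists a; rewrite A0 B0 in cS *; rewrite ?cards0 in cS; first lia.
  by rewrite /chains_downset; congr pr_set; lia.
- apply: Or32; exists B; first by rewrite inE Bd card_gt0.
  rewrite A0 in cS *; rewrite cards0 in cS; have := Bb BN0; have := card_gt0 B.
  by rewrite BN0 /right_downset => B1 ib; congr pr_set; lia.
- apply: Or31; exists A; first by rewrite inE Ad card_gt0.
  rewrite B0 in cS *; rewrite cards0 in cS; have := Aa AN0; have := card_gt0 A.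
  by rewrite AN0 /left_downset => A1 ia; congr pr_set; lia.
- have := Aa AN0; have := Bb BN0; have := card_gt0 A; have := card_gt0 B.
  rewrite AN0 BN0; lia.
Qed.

Lemma iso_left_downset D D' : D \in downsets P0 -> D' \in downsets P0 ->
  iso_sub (left_downset D) (left_downset D') = iso_sub D D'.
Proof.
move=> /left_downset_n/downsets_nP[Ld _] /left_downset_n/downsets_nP[Ld' _].
apply/idP/idP => [/(iso_pr_set_upper Ld Ld')|DD'].
  by rewrite !pr_set_left; apply: iso_sub_of_imset.
by rewrite /left_downset (card_iso_sub DD'); apply: iso_pr_set; rewrite ?iso_sub_refl.
Qed.

Lemma iso_right_downset E E' : E \in downsets R0 -> E' \in downsets R0 ->
  iso_sub (right_downset E) (right_downset E') = iso_sub E E'.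
Proof.
move=> /right_downset_n/downsets_nP[Rd _] /right_downset_n/downsets_nP[Rd' _].
apply/idP/idP => [/(iso_pr_set_upper Rd Rd')|EE'].
  by rewrite !pr_set_right; apply: iso_sub_of_imset.
by rewrite /right_downset (card_iso_sub EE'); apply: iso_pr_set; rewrite ?iso_sub_refl.
Qed.

Lemma iso_left_right_downset D E : D \in downsets P0 -> E \in downsets R0 ->
  iso_sub (left_downset D) (right_downset E) = iso_sub D E.
Proof.
move=> /left_downset_n/downsets_nP[Ld _] /right_downset_n/downsets_nP[Rd _].
apply/idP/idP => [/(iso_pr_set_upper Ld Rd)|DE].
  by rewrite pr_set_left pr_set_right; apply: iso_sub_of_imset.
rewrite /left_downset /right_downset (card_iso_sub DE).
by apply: iso_pr_set_swap => //; apply: iso_sub_set0.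
Qed.

Lemma iso_chains_downset a a' : m < a <= i -> m < a' <= i ->
  iso_sub (chains_downset a) (chains_downset a') = (maxn a (n - a) == maxn a' (n - a')).
Proof.
move=> ai a'i; apply/idP/eqP => [/max_below_iso|eqmax].
  by rewrite !max_below_chains; lia.
have [<-|->] : a' = a \/ a' = n - a by lia.
  exact: iso_sub_refl.
rewrite /chains_downset (_ : n - (n - a) = a); last by lia.
by apply: iso_pr_set_swap; apply: iso_sub_set0.
Qed.

Lemma not_iso_left_chains D a : D \in downsets P0 -> m < a <= i ->
  ~~ iso_sub (left_downset D) (chains_downset a).
Proof.
move=> DP ai; have /downsets_nP[Ld _] := left_downset_n DP.
have /downsets_nP[Cd _] := chains_downset_n ai.
apply/negP => /(iso_pr_set_upper Ld Cd)/card_iso_sub; rewrite !card_pr_set !cards0.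
by move: DP; rewrite inE => /andP[_ D0] ?; lia.
Qed.

Lemma not_iso_right_chains E a : E \in downsets R0 -> m < a <= i ->
  ~~ iso_sub (right_downset E) (chains_downset a).
Proof.
move=> EP ai; have /downsets_nP[Rd _] := right_downset_n EP.
have /downsets_nP[Cd _] := chains_downset_n ai.
apply/negP => /(iso_pr_set_upper Rd Cd)/card_iso_sub; rewrite !card_pr_set !cards0.
by move: EP; rewrite inE => /andP[_ E0] ?; lia.
Qed.

Local Notation chain_sizes := [set a : 'I_i.+1 | m < a].

Lemma chain_sizesP (a : 'I_i.+1) : a \in chain_sizes -> m < a <= i.
Proof. by rewrite inE => ->; rewrite -ltnS ltn_ord. Qed.

Lemma downsets_n_PR : downsets_n PR n =
  left_downset @: downsets P0 :|: right_downset @: downsets R0 :|: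
  [set chains_downset a | a : 'I_i.+1 in chain_sizes].
Proof.
apply/setP => S; apply/idP/idP => [Sn|].
  case: (downsets_n_cases Sn) => [[D DP ->]|[E EP ->]|[a ai ->]].
  - by rewrite !inE imset_f.
  - by rewrite !inE imset_f ?orbT.
  - have ai1 : a < i.+1 by case/andP: ai.
    by apply/setUP; right; apply/imsetP; exists (Ordinal ai1); rewrite // inE; case/andP: ai.
case/setUP => [/setUP[]|] /imsetP[X XP ->].
- exact: left_downset_n.
- exact: right_downset_n.
- exact/chains_downset_n/chain_sizesP.
Qed.

Lemma card_chains_classes :
  #|[set iso_class (chains_downset a) | a : 'I_i.+1 in chain_sizes]| = ceil_half (i - m).
Proof.
pose top (a : 'I_i.+1) : 'I_i.+1 := inord (maxn a (n - a)).
rewrite (@card_imset_eq_ker _ _ _ _ _ top); last first.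
  move=> a a' /chain_sizesP ai /chain_sizesP a'i.
  rewrite (eq_iso_class (inl (inl p0) : PR)) iso_chains_downset //.
  by rewrite -(inj_eq (@ord_inj i.+1)) !inordK; lia.
have -> : top @: chain_sizes = ~: [set b : 'I_i.+1 | b < n.+1./2].
  apply/setP => b; rewrite !inE; apply/imsetP/idP => [[a /chain_sizesP ai ->]|bn].
    by rewrite inordK; lia.
  have bi : b <= i by rewrite -ltnS ltn_ord.
  exists b; first by rewrite inE; lia.
  by apply: val_inj; rewrite /= inordK; lia.
have := cardsC [set b : 'I_i.+1 | b < n.+1./2]; rewrite card_ord card_ord_prefix /ceil_half.
lia.
Qed.

Lemma numDn_PR : numDn PR n = Cconst P0 R0 + ceil_half (i - m).
Proof.
pose x0 : PR := inl (inl p0).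
rewrite /numDn downsets_n_PR !imsetU -!imset_comp.
set IP := [set _ | _ in downsets P0]; set IR := [set _ | _ in downsets R0].
set IC := [set _ | _ in chain_sizes].
have cIP : #|IP| = numD P0.
  by apply: (card_iso_classes p0 x0) => D D' DP D'P; apply: iso_left_downset.
have cIR : #|IR| = numD R0.
  by apply: (card_iso_classes r0 x0) => E E' EP E'P; apply: iso_right_downset.
have cI : #|IP :&: IR| = numD_inter P0 R0.
  rewrite /numD_inter -(@card_iso_classes _ _ p0 x0 _ left_downset); last first.
    by move=> D D' /setIdP[DP _] /setIdP[D'P _]; apply: iso_left_downset.
  apply: eq_card => c; rewrite inE; apply/andP/imsetP.
  - case=> /imsetP[D DP ->] /imsetP[E EP /eqP]; rewrite /= (eq_iso_class x0).
    rewrite iso_left_right_downset // => DE.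
    by exists D => //; apply/setIdP; split=> //; apply/exists_inP; exists E.
  - case=> D /setIdP[DP /exists_inP[E EP DE]] ->; split; first exact: imset_f.
    by apply/imsetP; exists E => //; apply/eqP; rewrite (eq_iso_class x0) iso_left_right_downset.
have disj : (IP :|: IR) :&: IC = set0.
  apply/setP => c; rewrite !inE; apply/negbTE/negP => /andP[/orP[] /imsetP[X XP ->]];
    case/imsetP => a /chain_sizesP ai /eqP; rewrite /= (eq_iso_class x0); apply/negP.
  - exact: not_iso_left_chains.
  - exact: not_iso_right_chains.
by rewrite cardsU disj cards0 subn0 cardsU cIP cIR cI card_chains_classes.
Qed.

Lemma card_PR : #|PR| = (m + i) + (m + i).
Proof. by rewrite /= !card_sum !card_ord HRm. Qed.

Let bot : 'I_i := Ordinal (leq_ltn_trans (leq0n m) Hmi).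
Let botl : PR := inl (inr bot).
Let botr : PR := inr (inr bot).

Lemma le_botl y : le y botl -> y = botl.
Proof.
rewrite /botl /bot; case: y => [[p|k]|[r|k]] //= kb.
by congr (inl (inr _)); apply: val_inj => /=; lia.
Qed.

Lemma le_botr y : le y botr -> y = botr.
Proof.
rewrite /botr /bot; case: y => [[p|k]|[r|k]] //= kb.
by congr (inr (inr _)); apply: val_inj => /=; lia.
Qed.

Lemma bottoms_downsets_n S : S \in downsets_n PR n -> botl \in S /\ botr \in S.
Proof.
rewrite /botl /botr /bot.
case/downsets_n_cases => [[D _ ->]|[E _ ->]|[a ai ->]].
- have Dm : #|D| <= m := max_card D.
  by move: Dm; rewrite !inE /= => Dm; split; lia.
- have Em : #|E| <= m by rewrite -HRm; apply: max_card.
  by move: Em; rewrite !inE /= => Em; split; lia.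
- by move: ai; rewrite !inE /= => ai; split; lia.
Qed.

Lemma minimal_downsets_n S y : S \in downsets_n PR n -> y \in S ->
  (forall w, w \in S -> le w y -> w = y) -> y = botl \/ y = botr.
Proof.
move=> Sn yS ymin; have [bl br] := bottoms_downsets_n Sn.
by case: y yS ymin => [[p|k]|[r|k]] yS ymin; [left | left | right | right];
  apply/esym/ymin; rewrite // /botl /botr /bot.
Qed.

Local Notation left_component := (pr_set setT i set0 0).
Local Notation right_component := (pr_set set0 0 setT i).

Lemma left_component_downset : is_downset left_component.
Proof. by apply/pr_set_downsetP; rewrite ?downsetT ?downset0 ?eqxx. Qed.

Lemma right_component_downset : is_downset right_component.
Proof. by apply/pr_set_downsetP; rewrite ?downsetT ?downset0 ?eqxx. Qed.

Lemma card_left_component : #|left_component| = m + i.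
Proof. by rewrite card_pr_set cardsT cards0; lia. Qed.

Lemma card_right_component : #|right_component| = m + i.
Proof. by rewrite card_pr_set cardsT cards0 HRm; lia. Qed.

Lemma iso_components : iso_sub left_component right_component -> iso_poset P0 R0.
Proof.
move/(iso_pr_set_upper left_component_downset right_component_downset).
by rewrite pr_set_left pr_set_right; apply: iso_sub_of_imset.
Qed.

Lemma left_component_sub : left_component \subset left_downset setT.
Proof. by apply/subsetP => -[[p|k]|[r|k]]; rewrite !inE. Qed.

Lemma right_component_sub : right_component \subset right_downset setT.
Proof. by apply/subsetP => -[[p|k]|[r|k]]; rewrite !inE. Qed.

Lemma botl_left_component : botl \in left_component.
Proof. by rewrite inE /botl /=; apply: leq_ltn_trans Hmi. Qed.

Lemma botl_le_left_component : {in left_component, forall z, le botl z}.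
Proof. by rewrite /botl /bot => -[[p|k]|[r|k]]; rewrite !inE ?ltn0. Qed.

Lemma botr_nle_left_component : {in left_component, forall z, ~~ le botr z}.
Proof. by rewrite /botr => -[[p|k]|[r|k]]; rewrite !inE ?ltn0. Qed.

Lemma botr_le_right_component : {in right_component, forall z, le botr z}.
Proof. by rewrite /botr /bot => -[[p|k]|[r|k]]; rewrite !inE ?ltn0. Qed.

(** * Witnesses *)

Section Witness.
Variable Q : fposet.
Hypotheses (HQ : is_poset Q) (QPR : same_Dn n Q PR).

Lemma witness_no_least (B : {set Q}) (a : Q) :
  is_downset B -> n <= #|B| -> a \in B -> {in B, forall z, le a z} -> False.
Proof.
move=> Bd nB aB aleB.
have ad : is_downset [set a].
  case: HQ => _ Qa _; have /downsetP Bdown := Bd.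
  apply/downsetP => x z; rewrite !inE => /eqP-> za.
  by apply/eqP/Qa; rewrite za aleB //; apply: Bdown aB za.
have aB1 : [set a] \subset B by rewrite sub1set.
have an : #|[set a]| <= n <= #|B| by rewrite cards1 nB andbT addn1.
have [Z Zn [aZ ZB]] := exists_downset_between HQ ad Bd aB1 an.
have [S' S'n /iso_subP[g [gI gZ gle]]] := QPR.1 Z Zn.
have := bottoms_downsets_n S'n; rewrite -gZ => -[/imsetP[x xZ ex] /imsetP[y yZ ey]].
have aZx : {in Z, forall z, le (g a) (g z)}.
  by move=> z zZ; rewrite -gle ?aleB ?(subsetP ZB) // -sub1set.
have /le_botl ga_l : le (g a) botl by rewrite ex aZx.
have /le_botr ga_r : le (g a) botr by rewrite ey aZx.
by move: ga_r; rewrite ga_l.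
Qed.

Lemma witness_no_three_minimal (a b c : Q) : n <= #|Q| ->
  (forall y, le y a -> y = a) -> (forall y, le y b -> y = b) -> (forall y, le y c -> y = c) ->
  a != b -> a != c -> b != c -> False.
Proof.
move=> nQ am bm cm ab ac bc; set T := [set a; b; c].
have Td : is_downset T.
  apply/downsetP => x y; rewrite !inE => /orP[/orP[]|] /eqP-> yx.
  - by rewrite (am _ yx) eqxx.
  - by rewrite (bm _ yx) eqxx orbT.
  - by rewrite (cm _ yx) eqxx orbT.
have Tn : #|T| <= n <= #|[set: Q]|.
  rewrite cardsT nQ andbT; have m1 : 0 < m by apply/card_gt0P; exists p0.
  apply: (@leq_trans #|[:: a; b; c]|).
    by apply/subset_leq_card/subsetP => x; rewrite !inE -orbA.
  by apply: leq_trans (card_size _) _; rewrite /=; lia.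
have [Z Zn [TZ _]] := exists_downset_between HQ Td (downsetT Q) (subsetT T) Tn.
have [S' S'n /iso_subP[g [gI gZ gle]]] := QPR.1 Z Zn.
have gmin x : x \in T -> (forall y, le y x -> y = x) -> g x = botl \/ g x = botr.
  move=> /(subsetP TZ) xZ xm; apply: (minimal_downsets_n S'n); first by rewrite -gZ imset_f.
  by move=> w; rewrite -gZ => /imsetP[u uZ ->]; rewrite -gle // => /xm ->.
have gneq x y : x \in T -> y \in T -> x != y -> g x != g y.
  by move=> xT yT; apply: contra => /eqP/gI -> //; apply: (subsetP TZ).
have aT : a \in T by rewrite !inE eqxx.
have bT : b \in T by rewrite !inE eqxx orbT.
have cT : c \in T by rewrite !inE eqxx orbT.
have := gneq a b aT bT ab; have := gneq a c aT cT ac; have := gneq b c bT cT bc.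
by case: (gmin a aT am) => ->; case: (gmin b bT bm) => ->; case: (gmin c cT cm) => ->;
  rewrite ?eqxx.
Qed.

Lemma witness_components_distinct_bottoms (K L : {set Q}) (a : Q) :
  ~~ iso_poset P0 R0 -> is_downset K -> is_downset L ->
  iso_sub left_component K -> iso_sub right_component L ->
  a \in K -> {in K, forall z, le a z} -> {in L, forall z, le a z} -> False.
Proof.
move=> nPR Kd Ld LK RL aK aleK aleL.
have [KL|KNL] := eqVneq K L.
  move/negP: nPR; apply; apply: iso_components.
  by apply: iso_sub_trans LK _; rewrite KL; apply: iso_sub_sym botr RL.
have cK : #|K| = m + i by rewrite -(card_iso_sub LK) card_left_component.
have cL : #|L| = m + i by rewrite -(card_iso_sub RL) card_right_component.
have LNK : ~~ (L \subset K).
  by apply: (contra_neqN _ KNL) => LK'; apply/esym/eqP; rewrite eqEcard LK' cK cL leqnn.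
have nKL : n <= #|K :|: L| by rewrite addn1 -cK; apply/proper_card/properUl.
have KLd : is_downset (K :|: L).
  have /downsetP Kdown := Kd; have /downsetP Ldown := Ld.
  apply/downsetP => x y; rewrite !inE => /orP[xK|xL] yx.
    by rewrite (Kdown x y xK yx).
  by rewrite (Ldown x y xL yx) orbT.
apply: (witness_no_least KLd nKL (a := a)) => [|z /setUP[]].
- by apply/setUP; left.
- exact: aleK.
- exact: aleL.
Qed.

Lemma witness_card : ~~ iso_poset P0 R0 -> #|PR| <= #|Q|.
Proof.
move=> nPR.
have [S1 S1n /iso_subP[f1 [f1I f1S f1le]]] := QPR.2 _ (left_downset_n (downsetsT p0)).
have [S2 S2n /iso_subP[f2 [f2I f2S f2le]]] := QPR.2 _ (right_downset_n (downsetsT r0)).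
case/downsets_nP: (S1n) (S2n) => + cS1 /downsets_nP[+ _]; rewrite -f1S -f2S => S1d S2d.
have [bl1 br1] := bottoms_downsets_n (left_downset_n (downsetsT p0)).
have [_ br2] := bottoms_downsets_n (right_downset_n (downsetsT r0)).
set K := f1 @: left_component; set L := f2 @: right_component.
have LK : iso_sub left_component K := iso_sub_restrict f1le f1I left_component_sub.
have RL : iso_sub right_component L := iso_sub_restrict f2le f2I right_component_sub.
have a1K : {in K, forall z, le (f1 botl) z}.
  move=> _ /imsetP[z zL ->]; rewrite -f1le // ?(subsetP left_component_sub) //.
  exact: botl_le_left_component.
have b1K : {in K, forall z, ~~ le (f1 botr) z}.
  move=> _ /imsetP[z zL ->]; rewrite -f1le // ?(subsetP left_component_sub) //.
  exact: botr_nle_left_component.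
have a2L : {in L, forall z, le (f2 botr) z}.
  move=> _ /imsetP[z zR ->]; rewrite -f2le // ?(subsetP right_component_sub) //.
  exact: botr_le_right_component.
have a1a2 : f1 botl != f2 botr.
  apply/eqP => e; apply: (witness_components_distinct_bottoms nPR _ _ LK RL _ a1K).
  - exact: downset_image S1d f1le left_component_sub left_component_downset.
  - exact: downset_image S2d f2le right_component_sub right_component_downset.
  - exact/imset_f/botl_left_component.
  - by rewrite e.
have b1a2 : f1 botr = f2 botr.
  apply/eqP/negPn/negP => b1a2; apply: (witness_no_three_minimal _ _ _ _ _ a1a2 b1a2).
  - by rewrite -cS1 max_card.
  - exact: minimal_image S1d f1le bl1 le_botl.
  - exact: minimal_image S1d f1le br1 le_botr.
  - exact: minimal_image S2d f2le br2 le_botr.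
  - by apply: contraTneq isT => /f1I; rewrite /botl /botr => /(_ bl1 br1).
have KL0 : K :&: L = set0.
  apply/setP => x; rewrite !inE; apply/negbTE/negP => /andP[xK xL].
  by move: (b1K x xK); rewrite b1a2 a2L.
rewrite card_PR -{1}card_left_component -card_right_component.
rewrite (card_iso_sub LK) (card_iso_sub RL) -cardsUI KL0 cards0 addn0.
exact: max_card.
Qed.

End Witness.
End DownsetsOfPR.

Theorem mainTheorem6 (P0 R0 : fposet) (m i : nat) :
  is_poset P0 -> is_poset R0 ->
  psize P0 = m -> psize R0 = m ->
  ~~ iso_poset P0 R0 ->
  (m < i)%N ->
  let PR := disj_union (above_chain P0 i) (above_chain R0 i) in
  let n := (m + i + 1)%N in
  let k := (Cconst P0 R0 + ceil_half (i - m))%N in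
  [/\ covtree_node n PR /\ witness n PR PR,
      numDn PR n = k,
      psize PR = (2 * m + 2 * i)%N,
      (forall Q : fposet, witness n PR Q -> (psize PR <= psize Q)%N)
    & forall c : int,
        ((i%:Z - (ceil_half (i - m))%:Z) > 1 + (Cconst P0 R0)%:Z - m%:Z + c)%R ->
        ((psize PR)%:Z > n%:Z + k%:Z + c)%R].
Proof.
move=> HP HR hP hR nPR Hmi PR n k; rewrite /psize in hP hR *; subst m.
have [p0 _] : exists p : P0, p \in P0.
  apply/card_gt0P; rewrite lt0n; apply: contra nPR => /eqP P00.
  by apply: iso_poset_card0; rewrite ?hR.
have [r0 _] : exists r : R0, r \in R0 by apply/card_gt0P; rewrite hR; apply/card_gt0P; exists p0.
have cPR : #|PR| = 2 * #|P0| + 2 * i by rewrite card_PR //; lia.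
split.
- have w : witness n PR PR.
    by split; [exact: pr_poset | split=> S Sn; exists S => //; apply: iso_sub_refl].
  by split=> //; exists PR.
- exact: numDn_PR.
- exact: cPR.
- by move=> Q [HQ QPR]; apply: witness_card.
- by move=> c; rewrite cPR /n /k; lia.
Qed.
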